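(* Let $G$ be a group, $\mathsf V=\mathsf{Al}(T,\Sigma)$ a variety of algebras containing nontrivial algebras, and $(\theta,\mathcal A)\in\mathsf{pA}(G,\mathsf V)$. There exists a globalization of $(\theta,\mathcal A)$ in $\mathsf A(G,\mathsf V)$ if and only if $$([x,a],[y,b])\in\Theta_{\mathsf V}\ \Rightarrow\ [x,a]=[y,b]$$ for all $[x,a],[y,b]\in A^U$ seen as elements of $W_{\mathsf V}(A^U)$. In this case $(\boldsymbol\theta^{\mathbf U}_{\mathsf V},\mathcal W_{\mathsf V}(\mathcal A^U))$, with the map sending $a\in A$ to the $\Theta_{\mathsf V}$-class of $[1,a]$, is a universal globalization of $(\theta,\mathcal A)$ in $\mathsf A(G,\mathsf V)$.
   Context: Partial actions. A partial action of a group $G$ on a set $A$ is a partial map $\theta:G\times A\dashrightarrow A$ such that for all $x,y\in G$, $a\in A$: (i) $\theta(1,a)$ is defined and equals $a$; (ii) if $\theta(x,a)$ is defined, then $\theta(x^{-1},\theta(x,a))$ is defined and equals $a$; (iii) if $\theta(y,a)$ and $\theta(x,\theta(y,a))$ are defined, then $\theta(xy,a)$ is defined and equals $\theta(x,\theta(y,a))$. It is global if everywhere defined. One writes $xa$ for $\theta(x,a)$ and $xa\neq\varnothing$ for ''$xa$ is defined''. The domain $D_x$ is $\{\theta(x,a)\mid a\in A,\ \theta(x,a)\text{ defined}\}$, and $\theta_x=\theta(x,-)$ is a bijection $D_{x^{-1}}\to D_x$. A type of algebras is a sequence $T=\{n_\gamma\}_{\gamma<o(T)}$ of non-negative integers indexed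 by ordinals; algebras of type $T$ have total operations $f_\gamma$ of arity $n_\gamma$, partial algebras have partial operations. $\mathsf V=\mathsf{Al}(T,\Sigma)$ is the class of algebras of type $T$ satisfying all identities of the set $\Sigma$ (identities over a set $Y$). $\mathsf{pA}(G,\mathsf V)$ is the category of pairs $(\theta,\mathcal A)$ with $\mathcal A\in\mathsf V$ and $\theta$ a partial action of $G$ on the set $A$ such that every $D_x$ is a subalgebra $\mathcal D_x$ of $\mathcal A$ and every $\theta_x:\mathcal D_{x^{-1}}\to\mathcal D_x$ is an isomorphism. Morphisms $(\theta,\mathcal A)\to(\theta',\mathcal A')$ are homomorphisms $\varphi$ such that whenever $\theta(x,a)$ is defined, $\theta'(x,\varphi(a))$ is defined and equals $\varphi(\theta(x,a))$. $\mathsf A(G,\mathsf V)$ is the full subcategory of pairs with global $\theta$. Globalization. A globalization of $(\theta,\mathcal A)$ in $\mathsf A(G,\mathsf V)$ is $(\vartheta,\mathcal B)\in\mathsf A(G,\mathsf V)$ with an injective morphism $\iota:(\theta,\mathcal A)\to(\vartheta,\mathcal B)$ such that $xa\neq\varnothing\iff x\iota(a)\in\iota(A)$ for all $x\in G$, $a\in A$. It is universal if for any globalization $\iota':(\theta,\mathcal A)\to(\vartheta',\mathcal B')$ in $\mathsf A(G,\mathsf V)$ there is a unique morphism $\kappa:(\vartheta,\mathcal B)\to(\vartheta',\mathcal B')$ with $\iota'=\kappa\circ\iota$. The partial algebra $\mathcal A^U$. $A^U=(G\times A)/{\sim}$, where $(x,a)\sim(y,b)$ iff $(y^{-1}x)a$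 is defined and equals $b$; $[x,a]$ is the class of $(x,a)$; $\theta^U$ is the global action $x[y,a]=[xy,a]$. $\mathcal A^U$ is the partial algebra on $A^U$ with $f_\gamma([x,a_1],\dots,[x,a_{n_\gamma}])=[x,f_\gamma(a_1,\dots,a_{n_\gamma})]$ for $x\in G$, $a_i\in A$, and $f_\gamma$ undefined on tuples not of this form (for $n_\gamma=0$, $f_\gamma=[1,f_\gamma]$); this is well defined. Free algebras. $\mathcal W(X)$, with underlying set $W(X)$, is the free algebra of type $T$ over the set $X$ (formal terms, called words, in letters from $X$). $\overline{\theta^U}$ is the action of $G$ on $\mathcal W(A^U)$ applying $\theta^U(x,-)$ to each letter of a word. $\Phi$ is the congruence on $\mathcal W(X)$ generated by the pairs $(\varphi(w),\varphi(w'))$ with $(w=w')\in\Sigma$ and $\varphi:\mathcal W(Y)\to\mathcal W(X)$ a homomorphism; $\mathcal W_{\mathsf V}(X)=\mathcal W(X)/\Phi$, with underlying set $W_{\mathsf V}(X)$, is the free algebra over $X$ in $\mathsf V$. Since $\mathsf V$ contains nontrivial algebras, $X\to W_{\mathsf V}(X)$ is injective and $X$ is identified with its image. For a partial algebra $\mathcal C$ of type $T$ with underlying set $C$, $\Theta_{\mathsf V}$ is the congruence on $\mathcal W_{\mathsf V}(C)$ generated by the pairs $((f_\gamma)_{\mathcal W_{\mathsf V}(C)}(c_1,\dots,c_{n_\gamma}),(f_\gamma)_{\mathcal C}(c_1,\dots,c_{n_\gamma}))$ with $c_i\in C$ and $(f_\gamma)_{\mathcal C}(c_1,\dots,c_{n_\gamma})$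 defined; $\mathcal W_{\mathsf V}(\mathcal C)=\mathcal W_{\mathsf V}(C)/\Theta_{\mathsf V}$. Here $\mathcal C=\mathcal A^U$. The (well-defined) global action $\boldsymbol\theta^{\mathbf U}_{\mathsf V}$ of $G$ on $\mathcal W_{\mathsf V}(\mathcal A^U)$ is given by $\boldsymbol\theta^{\mathbf U}_{\mathsf V}(x,[[w]_\Phi]_{\Theta_{\mathsf V}})=[[\overline{\theta^U}(x,w)]_\Phi]_{\Theta_{\mathsf V}}$ for $w\in W(A^U)$. *)

(* Defs.v *)
From HB Require Import structures.
From Stdlib Require Import RelationClasses.
From mathcomp Require Import all_boot generic_quotient.
From mathcomp Require Import boolp classical_sets functions.

Set Implicit Arguments.
Unset Strict Implicit.
Unset Printing Implicit Defensive.

Local Open Scope quotient_scope.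
Local Open Scope classical_set_scope.
Local Open Scope group_scope.

(* Quotient of an arbitrary type by a Prop-valued equivalence relation: the
   generic quotients of MathComp, used classically. *)
Section Quotient.
Variables (T : Type) (R : T -> T -> Prop) (eqR : Equivalence R).

Definition brel : rel {classic T} := fun x y => `[< R x y >].

Lemma brel_refl : reflexive brel.
Proof. by move=> x; apply/asboolP; case: eqR => r _ _; exact: r. Qed.

Lemma brel_sym : symmetric brel.
Proof.
by move=> x y; apply/asboolP/asboolP; case: eqR => _ s _; exact: s.
Qed.

Lemma brel_trans : transitive brel.
Proof.
move=> y x z /asboolP xy /asboolP yz; apply/asboolP.
by case: eqR => _ _ t; exact: t xy yz.
Qed.

Definition brel_equiv := EquivRel brel brel_refl brel_sym brel_trans.

Definition quot : Type := {eq_quot brel_equiv}.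

Definition class_of (x : T) : quot := \pi_({eq_quot brel_equiv}) x.

Definition class_repr (q : quot) : T := repr (q : {eq_quot brel_equiv}).

Lemma class_reprK q : class_of (class_repr q) = q.
Proof. exact: reprK. Qed.

Lemma class_ofP x y : class_of x = class_of y <-> R x y.
Proof.
split=> [/eqmodP /= /asboolP // | Rxy].
by apply/eqmodP; apply/asboolP.
Qed.

Lemma class_of_repr x : R (class_repr (class_of x)) x.
Proof. by apply/class_ofP; rewrite class_reprK. Qed.

End Quotient.

Section QuotMap.
Variables (T T' : Type) (R : T -> T -> Prop) (R' : T' -> T' -> Prop).
Variables (eqR : Equivalence R) (eqR' : Equivalence R').

(* Meaningful only when f is compatible with R and R', see quot_mapE. *)
Definition quot_map (f : T -> T') (q : quot eqR) : quot eqR' :=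
  class_of eqR' (f (class_repr q)).

Lemma quot_mapE (f : T -> T') :
  (forall x y, R x y -> R' (f x) (f y)) ->
  forall x, quot_map f (class_of eqR x) = class_of eqR' (f x).
Proof.
move=> fR x; apply: (proj2 (class_ofP _ _ _)); apply: fR.
exact: class_of_repr.
Qed.

End QuotMap.

Arguments quot_map {T T' R R' eqR eqR'} f q.

(* The operation symbols are indexed by an arbitrary type; classically this is
   the same as indexing them by an ordinal. *)
Record alg_type := AlgType { symb : Type; arity : symb -> nat }.

Record algebra (T : alg_type) := Algebra {
  acarrier :> Type;
  op : forall g : symb T, ('I_(arity g) -> acarrier) -> acarrier }.

Record palgebra (T : alg_type) := PAlgebra {
  pacarrier :> Type;
  pop : forall g : symb T, ('I_(arity g) -> pacarrier) -> option pacarrier }.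

Arguments op {T a} g _.
Arguments pop {T p} g _.

Section UniversalAlgebra.
Variable T : alg_type.
Implicit Types A B : algebra T.

Definition homomorphism A B (f : A -> B) : Prop :=
  forall g (a : 'I_(arity g) -> A), f (op g a) = op g (fun i => f (a i)).

Definition subalgebra A (D : set A) : Prop :=
  forall g (a : 'I_(arity g) -> A), (forall i, D (a i)) -> D (op g a).

(* The partial map f is an isomorphism from the subalgebra D to the
   subalgebra E. *)
Definition partial_iso A (D E : set A) (f : A -> option A) : Prop :=
  set_bij D (Some @` E) f /\
  forall g (a b : 'I_(arity g) -> A), (forall i, D (a i)) ->
    (forall i, f (a i) = Some (b i)) -> f (op g a) = Some (op g b).

Record congruence A := Congruence {
  crel :> A -> A -> Prop;
  crel_equiv : Equivalence crel;
  crel_op : forall g (a b : 'I_(arity g) -> A),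
    (forall i, crel (a i) (b i)) -> crel (op g a) (op g b) }.

Section Generated.
Variables (A : algebra T) (P : A -> A -> Prop).

Definition gen_rel (a b : A) : Prop :=
  forall C : congruence A, (forall u v, P u v -> C u v) -> C a b.

Lemma gen_rel_equiv : Equivalence gen_rel.
Proof.
split.
- by move=> a C _; case: (crel_equiv C) => r _ _; exact: r.
- by move=> a b ab C PC; case: (crel_equiv C) => _ s _; exact: s (ab C PC).
- move=> a b c ab bc C PC; case: (crel_equiv C) => _ _ t.
  exact: t (ab C PC) (bc C PC).
Qed.

Lemma gen_rel_op g (a b : 'I_(arity g) -> A) :
  (forall i, gen_rel (a i) (b i)) -> gen_rel (op g a) (op g b).
Proof. by move=> ab C PC; apply: crel_op => i; exact: ab. Qed.

Definition gen_congruence : congruence A :=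
  Congruence gen_rel_equiv gen_rel_op.

Lemma gen_congruence_in u v : P u v -> gen_congruence u v.
Proof. by move=> Puv C; exact. Qed.

End Generated.

Lemma gen_congruence_map A B (f : A -> B) (P : A -> A -> Prop)
    (C : congruence B) : homomorphism f ->
  (forall u v, P u v -> C (f u) (f v)) ->
  forall u v, gen_congruence P u v -> C (f u) (f v).
Proof.
move=> fhom PC u v.
have [r s t] := crel_equiv C.
have eqD : Equivalence (fun a b => C (f a) (f b)).
  split; [by move=> a; exact: r | by move=> a b; exact: s |].
  by move=> a b c; exact: t.
have opD g (a b : 'I_(arity g) -> A) : (forall i, C (f (a i)) (f (b i))) ->
    C (f (op g a)) (f (op g b)).
  by move=> ab; rewrite !fhom; exact: crel_op.
by move=> /(_ (Congruence eqD opD)); exact.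
Qed.

Section QuotientAlgebra.
Variables (A : algebra T) (C : congruence A).

Definition quot_alg : algebra T :=
  @Algebra T (quot (crel_equiv C))
    (fun g q => class_of (crel_equiv C) (op g (fun i => class_repr (q i)))).

Definition quot_class (a : A) : quot_alg := class_of (crel_equiv C) a.

Lemma quot_classP a b : quot_class a = quot_class b <-> C a b.
Proof. exact: class_ofP. Qed.

Lemma quot_class_hom : homomorphism quot_class.
Proof.
move=> g a; apply/esym/class_ofP/crel_op => i; exact: class_of_repr.
Qed.

End QuotientAlgebra.

Lemma quot_map_hom (A : algebra T) (C : congruence A) (f : A -> A) :
  homomorphism f -> (forall u v, C u v -> C (f u) (f v)) ->
  @homomorphism (quot_alg C) (quot_alg C) (quot_map f).
Proof.
move=> fhom fC g q; rewrite /= quot_mapE // fhom.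
rewrite -/(quot_class C _) quot_class_hom; congr (@op T (quot_alg C) g _).
Qed.

Inductive word (X : Type) : Type :=
| Letter (x : X)
| Apply (g : symb T) (ws : 'I_(arity g) -> word X).

Definition word_alg (X : Type) : algebra T := @Algebra T (word X) (@Apply X).

Fixpoint word_map (X X' : Type) (h : X -> X') (w : word X) : word X' :=
  match w with
  | Letter x => Letter (h x)
  | Apply g ws => Apply (fun i => word_map h (ws i))
  end.

Lemma word_map_hom X X' (h : X -> X') :
  @homomorphism (word_alg X) (word_alg X') (word_map h).
Proof. by []. Qed.

Lemma word_map_id X (w : word X) : word_map id w = w.
Proof. by elim: w => //= g ws IH; congr Apply; apply/funext. Qed.

Lemma word_map_comp X1 X2 X3 (h : X1 -> X2) (k : X2 -> X3) (w : word X1) :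
  word_map k (word_map h w) = word_map (fun x => k (h x)) w.
Proof. by elim: w => //= g ws IH; congr Apply; apply/funext. Qed.

Lemma word_hom_lift (Y : Type) A (C : congruence A)
    (phi : word_alg Y -> quot_alg C) : homomorphism phi ->
  exists2 psi : word_alg Y -> A, homomorphism psi &
    forall w, phi w = quot_class C (psi w).
Proof.
move=> phih.
pose psi := fix psi (w : word Y) : A :=
  match w with
  | Letter y => class_repr (phi (Letter y))
  | Apply g ws => op g (fun i => psi (ws i))
  end.
exists psi; first by [].
elim=> [y|g ws IH]; first by rewrite /quot_class class_reprK.
have -> : phi (Apply ws) = op g (fun i => phi (ws i)) by exact: (phih g ws).
have -> : quot_class C (psi (Apply ws)) =
  op g (fun i => quot_class C (psi (ws i))) by exact: quot_class_hom.
congr (@op T (quot_alg C) g _); exact/funext.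
Qed.

Section Variety.
Variables (Y : Type) (Sigma : set (word Y * word Y)).

Definition Al (A : algebra T) : Prop :=
  forall w w', Sigma (w, w') ->
  forall phi : word_alg Y -> A, homomorphism phi -> phi w = phi w'.

Definition has_nontrivial : Prop :=
  exists2 A : algebra T, Al A & exists a b : A, a <> b.

Lemma Al_quot A (C : congruence A) : Al A -> Al (quot_alg C).
Proof.
move=> AV w w' Sw phi /word_hom_lift[psi psih phiE].
by rewrite !phiE (AV _ _ Sw).
Qed.

Definition Phi (X : Type) : congruence (word_alg X) :=
  gen_congruence (fun u v => exists w w' (phi : word_alg Y -> word_alg X),
    [/\ Sigma (w, w'), homomorphism phi, u = phi w & v = phi w']).

Definition freeV (X : Type) : algebra T := quot_alg (Phi X).

Definition letterV (X : Type) (x : X) : freeV X :=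
  quot_class (Phi X) (Letter x).

Lemma freeV_Al X : Al (freeV X).
Proof.
move=> w w' Sw phi /word_hom_lift[psi psih phiE].
rewrite !phiE; apply/quot_classP/gen_congruence_in.
by exists w, w', psi.
Qed.

Definition ThetaV (C : palgebra T) : congruence (freeV C) :=
  gen_congruence (fun u v => exists g (c : 'I_(arity g) -> C) (d : C),
    [/\ pop g c = Some d, u = op g (fun i => letterV (c i)) & v = letterV d]).

Definition WV (C : palgebra T) : algebra T := quot_alg (ThetaV C).

Lemma WV_Al C : Al (WV C).
Proof. exact/Al_quot/freeV_Al. Qed.

(* [[w]_Phi]_Theta *)
Definition word_class (C : palgebra T) (w : word C) : WV C :=
  quot_class (ThetaV C) (quot_class (Phi C) w).

Lemma word_class_surj C (q : WV C) : exists w, q = word_class w.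
Proof.
exists (class_repr (class_repr q : freeV C)).
by rewrite /word_class /quot_class !class_reprK.
Qed.

End Variety.

End UniversalAlgebra.

Arguments Letter {T X} x.
Arguments Apply {T X} g ws.

Record partial_action (G : groupType) (A : Type) := PartialAction {
  pact :> G -> A -> option A;
  pact1 : forall a, pact 1 a = Some a;
  pactV : forall x a b, pact x a = Some b -> pact x^-1 b = Some a;
  pactM : forall x y a b c, pact y a = Some b -> pact x b = Some c ->
    pact (x * y) a = Some c }.

Section PartialAction.
Variables (G : groupType) (A : Type).

Definition pdom (th : partial_action G A) (x : G) : set A :=
  [set b | exists a, th x a = Some b].

Definition is_global (th : partial_action G A) : Prop :=
  forall x a, th x a <> None.

Section OfGlobal.
Variables (f : G -> A -> A) (f1 : forall a, f 1 a = a).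
Variable fM : forall x y a, f (x * y) a = f x (f y a).

Definition global_action : partial_action G A.
Proof.
refine (@PartialAction G A (fun x a => Some (f x a)) _ _ _).
- by move=> a; rewrite f1.
- by move=> x a _ [<-]; rewrite -fM mulVg f1.
- by move=> x y a _ _ [<-] [<-]; rewrite fM.
Defined.

Lemma global_actionP : is_global global_action. Proof. by []. Qed.

End OfGlobal.

Variable th : partial_action G A.

Definition AU_rel (p q : G * A) : Prop := th (q.1^-1 * p.1) p.2 = Some q.2.

Lemma AU_rel_equiv : Equivalence AU_rel.
Proof.
split.
- by move=> [x a]; rewrite /AU_rel /= mulVg pact1.
- move=> [x a] [y b] xy; have := pactV xy; rewrite /AU_rel /=.
  by rewrite invgM invgK.
- move=> [x a] [y b] [z c] /= xy yz; rewrite /AU_rel /=.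
  by have := pactM xy yz; rewrite /= mulgA mulgK.
Qed.

Definition AU : Type := quot AU_rel_equiv.

(* [x, a] *)
Definition AU_class (x : G) (a : A) : AU := class_of AU_rel_equiv (x, a).

Definition AU_act (x : G) : AU -> AU :=
  quot_map (fun p : G * A => (x * p.1, p.2)).

Lemma AU_actE x y a : AU_act x (AU_class y a) = AU_class (x * y) a.
Proof.
rewrite /AU_act /AU_class quot_mapE // => -[z b] [t c].
by rewrite /AU_rel /= invgM -mulgA mulKg.
Qed.

Lemma AU_classP x a y b :
  AU_class x a = AU_class y b <-> th (y^-1 * x) a = Some b.
Proof. exact: class_ofP. Qed.

Lemma AU_class_surj q : exists x a, q = AU_class x a.
Proof.
exists (class_repr q).1, (class_repr q).2.
by rewrite /AU_class -surjective_pairing class_reprK.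
Qed.

Lemma AU_act1 q : AU_act 1 q = q.
Proof. by have [x [a ->]] := AU_class_surj q; rewrite AU_actE mul1g. Qed.

Lemma AU_actM x y q : AU_act (x * y) q = AU_act x (AU_act y q).
Proof. by have [z [a ->]] := AU_class_surj q; rewrite !AU_actE mulgA. Qed.

End PartialAction.

(* Objects of pA(G, V), for V = Al Sigma. *)
Record pA (G : groupType) (T : alg_type) (Y : Type)
    (Sigma : set (word T Y * word T Y)) := PA {
  pA_alg :> algebra T;
  pA_act : partial_action G pA_alg;
  pA_Al : Al Sigma pA_alg;
  pA_sub : forall x, subalgebra (pdom pA_act x);
  pA_iso : forall x,
    partial_iso (pdom pA_act x^-1) (pdom pA_act x) (pA_act x) }.

Section Globalization.
Variables (G : groupType) (T : alg_type) (Y : Type).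
Variable Sigma : set (word T Y * word T Y).
Implicit Types X B : pA G Sigma.

Definition is_morphism X B (phi : X -> B) : Prop :=
  homomorphism phi /\
  forall x a b, pA_act X x a = Some b -> pA_act B x (phi a) = Some (phi b).

Definition in_A X : Prop := is_global (pA_act X).

Definition is_globalization X B (iota : X -> B) : Prop :=
  [/\ in_A B, is_morphism iota, injective iota &
      forall x a, pA_act X x a <> None <->
        exists c, pA_act B x (iota a) = Some (iota c)].

Definition has_globalization X : Prop :=
  exists (B : pA G Sigma) (iota : X -> B), is_globalization iota.

Definition is_universal_globalization X B (iota : X -> B) : Prop :=
  is_globalization iota /\
  forall (B' : pA G Sigma) (iota' : X -> B'), is_globalization iota' ->
    exists! kappa : B -> B', is_morphism kappa /\ iota' = kappa \o iota.

Section GlobalAct.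
Variables (B : algebra T) (BV : Al Sigma B) (f : G -> B -> B).
Hypotheses (f1 : forall a, f 1 a = a).
Hypothesis fM : forall x y a, f (x * y) a = f x (f y a).
Hypothesis fhom : forall x, homomorphism (f x).

Let pdomT x b : pdom (global_action f1 fM) x b.
Proof. by exists (f x^-1 b); rewrite /= -fM mulgV f1. Qed.

Definition global_pA : pA G Sigma.
Proof.
refine (@PA G T Y Sigma B (global_action f1 fM) BV _ _).
- by move=> x g a _; exact: pdomT.
- move=> x; split; last first.
    move=> g a b _ fab; rewrite /= fhom; congr (Some (op g _)).
    by apply/funext => i; case: (fab i).
  split.
  + by move=> b _; exists (f x b).
  + by move=> a b _ _ [] /(congr1 (f x^-1)); rewrite -!fM mulVg !f1.
  + by move=> _ [b _ <-]; exists (f x^-1 b) => //=; rewrite -fM mulgV f1.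
Defined.

End GlobalAct.

Section Construction.
Variable X : pA G Sigma.
Let th := pA_act X.

(* f_g([x,a_1], ..., [x,a_n]) = [x, f_g(a_1, ..., a_n)]; the choice of x and of
   the a_i is irrelevant, see AU_popE. *)
Definition AU_pop (g : symb T) (c : 'I_(arity g) -> AU th) : option (AU th) :=
  match pselect (exists p : G * ('I_(arity g) -> X),
                   c = fun i => AU_class th p.1 (p.2 i)) with
  | left h => let p := projT1 (cid h) in Some (AU_class th p.1 (op g p.2))
  | right _ => None
  end.

Definition AU_palg : palgebra T := PAlgebra AU_pop.

Lemma AU_popE g x (a : 'I_(arity g) -> X) :
  AU_pop (fun i => AU_class th x (a i)) = Some (AU_class th x (op g a)).
Proof.
rewrite /AU_pop; case: pselect => [h|[]]; last by exists (x, a).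
case: cid => -[y b] /= /(congr1 (@^~ _)) E; congr Some; apply/AU_classP.
have {}E i : th (x^-1 * y) (b i) = Some (a i).
  by apply/AU_classP; rewrite (E i).
apply: (pA_iso X (x^-1 * y)).2 => // i.
by exists (a i); apply: pactV.
Qed.

Lemma AU_pop_Some g (c : 'I_(arity g) -> AU th) d : AU_pop c = Some d ->
  exists x (a : 'I_(arity g) -> X),
    c = (fun i => AU_class th x (a i)) /\ d = AU_class th x (op g a).
Proof.
rewrite /AU_pop; case: pselect => // h; case: cid => -[x a] /= -> [<-].
by exists x, a.
Qed.

Lemma AU_pop_act x g (c : 'I_(arity g) -> AU th) d : AU_pop c = Some d ->
  AU_pop (fun i => AU_act x (c i)) = Some (AU_act x d).
Proof.
move=> /AU_pop_Some[y [a [-> ->]]]; rewrite AU_actE -AU_popE.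
by congr AU_pop; apply/funext => i; rewrite AU_actE.
Qed.

Definition word_act (x : G) : word_alg T AU_palg -> word_alg T AU_palg :=
  word_map (@AU_act _ _ th x).

Lemma word_act_Phi x u v : Phi Sigma _ u v ->
  Phi Sigma _ (word_act x u) (word_act x v).
Proof.
apply: gen_congruence_map; first exact: word_map_hom.
move=> _ _ [w [w' [phi [Sw phih -> ->]]]]; apply: gen_congruence_in.
exists w, w', (fun w => word_act x (phi w)); split=> // g a.
by rewrite /= phih.
Qed.

Definition freeV_act (x : G) : freeV Sigma AU_palg -> freeV Sigma AU_palg :=
  quot_map (word_act x).

Lemma freeV_actE x w : freeV_act x (quot_class (Phi Sigma _) w) =
  quot_class (Phi Sigma _) (word_act x w).
Proof. by apply: quot_mapE; exact: word_act_Phi. Qed.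

Lemma freeV_act_hom x : homomorphism (freeV_act x).
Proof. by apply: quot_map_hom; [exact: word_map_hom | exact: word_act_Phi]. Qed.

Lemma freeV_act_Theta x u v : ThetaV Sigma AU_palg u v ->
  ThetaV Sigma AU_palg (freeV_act x u) (freeV_act x v).
Proof.
apply: gen_congruence_map; first exact: freeV_act_hom.
move=> _ _ [g [c [d [cd -> ->]]]]; apply: gen_congruence_in.
exists g, (fun i => AU_act x (c i)), (AU_act x d); split.
- exact: AU_pop_act.
- rewrite freeV_act_hom; congr (op g _); apply/funext => i.
  exact: freeV_actE.
- exact: freeV_actE.
Qed.

Definition thetaUV (x : G) : WV Sigma AU_palg -> WV Sigma AU_palg :=
  quot_map (freeV_act x).

Lemma thetaUVE x w :
  thetaUV x (word_class Sigma w) = word_class Sigma (word_act x w).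
Proof.
rewrite /word_class -freeV_actE.
by apply: quot_mapE; exact: freeV_act_Theta.
Qed.

Lemma thetaUV_hom x : homomorphism (thetaUV x).
Proof.
by apply: quot_map_hom; [exact: freeV_act_hom | exact: freeV_act_Theta].
Qed.

Lemma thetaUV1 q : thetaUV 1 q = q.
Proof.
have [w ->] := word_class_surj q; rewrite thetaUVE /word_act.
by rewrite (funext (@AU_act1 _ _ th)) word_map_id.
Qed.

Lemma thetaUVM x y q : thetaUV (x * y) q = thetaUV x (thetaUV y q).
Proof.
have [w ->] := word_class_surj q; rewrite !thetaUVE /word_act word_map_comp.
by congr (word_class _ (word_map _ _)); apply/funext => p; rewrite AU_actM.
Qed.

(* The pair formed by the algebra WV(A^U) and the action thetaUV. *)
Definition WVU : pA G Sigma :=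
  global_pA (WV_Al (Sigma := Sigma) (C := AU_palg)) thetaUV1 thetaUVM
    thetaUV_hom.

Definition iotaU (a : X) : WVU :=
  quot_class (ThetaV Sigma AU_palg) (letterV Sigma (AU_class th 1 a)).

End Construction.

End Globalization.

Arguments AU_pop {G T Y Sigma} X g c.
Arguments iotaU {G T Y Sigma} X a.
Arguments is_universal_globalization {G T Y Sigma} X B iota.

(* Main.v *)
Require Import Defs.
From Stdlib Require Import RelationClasses.
From mathcomp Require Import all_boot.
From mathcomp Require Import boolp classical_sets functions.

(** The algebra [WV Sigma C] is the free algebra of the variety on the partial
    algebra [C]: a map from [C] to an algebra of the variety that respects the
    operations defined in [C] extends uniquely to a homomorphism
    ([WV_universal], [WV_hom_ext]). The theorem is this universal property, in
    its version with a [G]-action, for [C] the partial algebra on [A^U].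

    Suppose that [iota : X -> B] is a globalization. Since the group acts
    everywhere on [B], the rule sending [[x, a]] to the translate of [iota a]
    by [x] defines a map from [A^U] to [B]. It respects the partial operations,
    because every operation of [A^U] takes place inside one translate of [A],
    and the condition that [xa] be defined exactly when [x iota(a)] lies in
    [iota(A)] makes it injective ([AU_to_inj]). Hence it extends to
    a homomorphism from [WV] to [B], which separates the letters; in
    particular two letters congruent modulo [ThetaV] must be equal.

    Conversely, if [ThetaV] does not identify distinct letters, then [A^U]
    embeds in [WV], so that [[x, a]] equals [[1, c]] in [WV] only if [xa] is
    defined and equal to [c]; this is what a globalization requires
    ([WVU_globalization]). It is universal because the homomorphism to [B] just
    described commutes with the actions, and because [WV] is generated as
    an algebra by the translates of the image of [A]. *)

Set Implicit Arguments.
Unset Strict Implicit.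
Unset Printing Implicit Defensive.

Local Open Scope classical_set_scope.
Local Open Scope group_scope.

(** * The universal property of the free algebra on a partial algebra *)

Section UniversalProperty.
Variable T : alg_type.

Lemma eq_op_compat (B : algebra T) g (a b : 'I_(arity g) -> B) :
  (forall i, a i = b i) -> op g a = op g b.
Proof. by move=> ab; congr (op g _); apply/funext. Qed.

(** Turns [gen_congruence_map] into a criterion for a homomorphism to be
    constant on the classes of a generated congruence. *)
Definition eq_congruence (B : algebra T) : congruence B :=
  Congruence (eq_equivalence (A := B)) (@eq_op_compat B).

Lemma quot_hom_lift (A B : algebra T) (P : A -> A -> Prop) (f : A -> B) :
  homomorphism f -> (forall u v, P u v -> f u = f v) ->
  exists2 k : quot_alg (gen_congruence P) -> B, homomorphism k &
    forall a, k (quot_class (gen_congruence P) a) = f a.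
Proof.
move=> fhom fP; pose C := gen_congruence P.
have fC u v : C u v -> f u = f v.
  exact: (gen_congruence_map (C := eq_congruence B) fhom fP).
pose k (q : quot_alg C) := f (class_repr q).
have kE a : k (quot_class C a) = f a.
  by apply: fC; exact: (class_of_repr (crel_equiv C)).
exists k => // g q; rewrite -fhom -kE quot_class_hom.
by congr (k (op g _)); apply/funext => i; rewrite /quot_class class_reprK.
Qed.

Fixpoint word_eval (C : Type) (B : algebra T) (h : C -> B) (w : word T C) :
    B :=
  match w with
  | Letter c => h c
  | Apply g ws => op g (fun i => word_eval h (ws i))
  end.

Variables (Y : Type) (Sigma : set (word T Y * word T Y)).

(** An identity of [Sigma] holds in [B], which removes the relations [Phi]; the
    compatibility of [h] with the partial operations removes [ThetaV]. *)
Lemma WV_universal (C : palgebra T) (B : algebra T) (h : C -> B) :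
    Al Sigma B ->
    (forall g (c : 'I_(arity g) -> C) d,
       pop g c = Some d -> h d = op g (fun i => h (c i))) ->
  exists2 k : WV Sigma C -> B, homomorphism k &
    forall c, k (word_class Sigma (Letter c)) = h c.
Proof.
move=> BV hpop.
have hhom : @homomorphism T (word_alg T C) B (word_eval h) by [].
have [|k khom kE] :=
    quot_hom_lift (P := fun u v =>
        exists w w' (phi : word_alg T Y -> word_alg T C),
      [/\ Sigma (w, w'), homomorphism phi, u = phi w & v = phi w']) hhom.
  move=> _ _ [w [w' [phi [Sw phih -> ->]]]].
  by apply: (BV _ _ Sw (fun w => word_eval h (phi w))) => g a; rewrite phih.
have [|l lhom lE] := quot_hom_lift
    (P := fun u v : freeV Sigma C => exists g (c : 'I_(arity g) -> C) (d : C),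
      [/\ pop g c = Some d, u = op g (fun i => letterV Sigma (c i))
        & v = letterV Sigma d]) khom.
  move=> _ _ [g [c [d [cd -> ->]]]]; rewrite khom [RHS]kE /= (hpop _ _ _ cd).
  by congr (op g _); apply/funext => i; rewrite [LHS]kE.
by exists l => // c; rewrite [LHS]lE [LHS]kE.
Qed.

Lemma word_class_op (C : palgebra T) g (ws : 'I_(arity g) -> word T C) :
  word_class Sigma (Apply g ws) = op g (fun i => word_class Sigma (ws i)).
Proof.
rewrite /word_class -quot_class_hom; congr (quot_class _ _).
exact: (quot_class_hom (Phi Sigma C) (g := g)).
Qed.

Lemma WV_hom_ext (C : palgebra T) (B : algebra T) (k l : WV Sigma C -> B) :
    homomorphism k -> homomorphism l ->
    (forall c, k (word_class Sigma (Letter c)) =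
               l (word_class Sigma (Letter c))) ->
  k = l.
Proof.
move=> khom lhom kl; apply/funext => q; have [w ->] := word_class_surj q.
elim: w => [c|g ws IH]; first exact: kl.
by rewrite word_class_op khom lhom; congr (op g _); apply/funext.
Qed.

Lemma WV_letter_op (C : palgebra T) g (c : 'I_(arity g) -> C) d :
  pop g c = Some d ->
  word_class Sigma (Letter d) = op g (fun i => word_class Sigma (Letter (c i))).
Proof.
move=> cd; rewrite -quot_class_hom; apply/esym/quot_classP.
by apply: gen_congruence_in; exists g, c, d.
Qed.

End UniversalProperty.

(** * Global actions as families of automorphisms *)

Section GlobalAction.
Variables (G : groupType) (T : alg_type) (Y : Type).
Variables (Sigma : set (word T Y * word T Y)) (B : pA G Sigma).
Hypothesis BA : in_A B.

(** The action of an object of [A(G, V)] as a total function; the default value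
    [b] is never taken, see [total_actE]. *)
Definition total_act (x : G) (b : B) : B := odflt b (pA_act B x b).

Lemma total_actE x b : pA_act B x b = Some (total_act x b).
Proof. by rewrite /total_act; case: (pA_act B x b) (@BA x b). Qed.

Lemma total_act1 b : total_act 1 b = b.
Proof. by rewrite /total_act pact1. Qed.

Lemma total_actM x y b : total_act (x * y) b = total_act x (total_act y b).
Proof.
apply: Some_inj; rewrite -total_actE.
by rewrite (pactM (total_actE y b) (total_actE x _)).
Qed.

Lemma total_act_hom x : homomorphism (total_act x).
Proof.
move=> g a; apply: Some_inj; rewrite -total_actE.
apply: (pA_iso B x).2 => i; last exact: total_actE.
by exists (total_act x (a i)); apply: pactV; exact: total_actE.
Qed.

End GlobalAction.

(** * Globalizations and letters of [WV] *)

Section Main.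
Variables (G : groupType) (T : alg_type) (Y : Type).
Variables (Sigma : set (word T Y * word T Y)) (X : pA G Sigma).

Local Notation "[ x , a ]" := (AU_class (pA_act X) x a).
Local Notation letter p := (word_class Sigma (C := AU_palg X) (Letter p)).

Lemma thetaUV_letter x y a : thetaUV x (letter [y, a]) = letter [x * y, a].
Proof. by rewrite thetaUVE /word_act /= AU_actE. Qed.

Section FromGlobalization.
Variables (B : pA G Sigma) (iota : X -> B).
Hypothesis iotaP : is_globalization iota.

Let BA : in_A B. Proof. by case: iotaP. Qed.

(** This sends [[x, a]] to [x iota(a)]; a chosen representative stands for the
    class, and [AU_toE] shows that the choice does not matter. *)
Definition AU_to (p : AU (pA_act X)) : B :=
  total_act (class_repr p).1 (iota (class_repr p).2).

Lemma AU_toE x a : AU_to [x, a] = total_act x (iota a).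
Proof.
have := class_of_repr (AU_rel_equiv (pA_act X)) (x, a).
rewrite /AU_to -/(AU_class _ x a); case: (class_repr _) => y b /= yb.
have [_ [_ iotaM] _ _] := iotaP.
have := iotaM _ _ _ yb; rewrite (total_actE BA) /= => -[<-].
by rewrite -(total_actM BA) mulgA mulgV mul1g.
Qed.

(** If [x iota(a) = y iota(b)] then [(y^-1 x) iota(a)] lies in the image of
    [iota], so that [(y^-1 x) a] is already defined in [X]. *)
Lemma AU_to_inj : injective AU_to.
Proof.
move=> p q; have [x [a ->]] := AU_class_surj p.
have [y [b ->]] := AU_class_surj q; rewrite !AU_toE => xy.
have [_ [_ iotaM] iota_inj iota_dom] := iotaP.
have yxE : pA_act B (y^-1 * x) (iota a) = Some (iota b).
  rewrite (total_actE BA) (total_actM BA) xy -(total_actM BA).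
  by rewrite mulVg total_act1.
apply/AU_classP; case E: (pA_act X _ a) => [c|].
  by congr Some; apply: iota_inj; apply: Some_inj; rewrite -yxE (iotaM _ _ _ E).
have : pA_act X (y^-1 * x) a <> None by apply/iota_dom; exists b.
by rewrite E.
Qed.

Lemma AU_to_pop g (c : 'I_(arity g) -> AU_palg X) d :
  pop g c = Some d -> AU_to d = op g (fun i => AU_to (c i)).
Proof.
have [_ [iotah _] _ _] := iotaP.
move=> /AU_pop_Some[x [a [-> ->]]]; rewrite AU_toE iotah (total_act_hom BA).
by congr (op g _); apply/funext => i; rewrite AU_toE.
Qed.

Lemma WVU_extension : exists2 k : WVU X -> B, homomorphism k &
  forall p, k (letter p) = AU_to p.
Proof.
exact: (WV_universal (C := AU_palg X) (@pA_Al _ _ _ _ B) AU_to_pop).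
Qed.

Lemma letter_inj p q : letter p = letter q -> p = q.
Proof.
have [k _ kE] := WVU_extension.
by move=> /(congr1 k); rewrite !kE => /AU_to_inj.
Qed.

(** A morphism commutes with the actions, so its values at the letters [[x, a]]
    are forced by those at [[1, a]]; two homomorphisms equal at the letters are
    equal, and this gives both uniqueness and equivariance. *)
Lemma WVU_factor : exists! kappa : WVU X -> B,
  is_morphism kappa /\ iota = kappa \o iotaU X.
Proof.
have [k khom kE] := WVU_extension.
exists k; split=> [|k' [[k'hom k'M] k'iota]]; last first.
  apply: WV_hom_ext => // p; have [x [a ->]] := AU_class_surj p.
  rewrite kE AU_toE k'iota /=; apply: Some_inj; rewrite -(total_actE BA).
  rewrite (k'M x _ (letter [x, a])) //.
  by congr Some; rewrite -[X in [X, a]]mulg1 -thetaUV_letter.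
split; last first.
  by apply/funext => a /=; rewrite [RHS]kE AU_toE total_act1.
split=> // x q _ [<-]; rewrite (total_actE BA); congr Some.
apply: (congr1 (@^~ q) (x := total_act x \o k) (y := k \o thetaUV x)).
apply: WV_hom_ext => [g a|g a|p].
- by rewrite /= khom (total_act_hom BA).
- by rewrite /= thetaUV_hom khom.
- have [y [a ->]] := AU_class_surj p.
  by rewrite /= thetaUV_letter !kE !AU_toE (total_actM BA).
Qed.

End FromGlobalization.

Lemma letterP p q : letter p = letter q <->
  ThetaV Sigma (AU_palg X) (letterV Sigma p) (letterV Sigma q).
Proof. exact: quot_classP. Qed.

Lemma WVU_globalization :
    (forall p q : AU (pA_act X), letter p = letter q -> p = q) ->
  is_globalization (iotaU X).
Proof.
move=> inj.
have actE x a : pA_act (WVU X) x (iotaU X a) = Some (letter [x, a]).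
  by congr Some; rewrite [LHS]thetaUV_letter mulg1.
have iota_eq x a b : letter [x, a] = iotaU X b -> pA_act X x a = Some b.
  by move=> /inj/AU_classP; rewrite invg1 mul1g.
have act_iota x a b : pA_act X x a = Some b -> letter [x, a] = iotaU X b.
  move=> xab; congr (word_class _ (Letter _)); apply/AU_classP.
  by rewrite invg1 mul1g.
split.
- by [].
- split=> [g a|x a b xab]; last by rewrite actE (act_iota _ _ _ xab).
  apply: (@WV_letter_op _ _ Sigma (AU_palg X) g (fun i => [1, a i])).
  exact: AU_popE.
- by move=> a b /iota_eq; rewrite pact1 => -[].
- move=> x a; split=> [|[c]].
    case E: (pA_act X x a) => [b|] // _; exists b.
    by rewrite actE (act_iota _ _ _ E).
  by rewrite actE => -[/iota_eq ->].
Qed.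

End Main.

Theorem theorem3p27 (G : groupType) (T : alg_type) (Y : Type)
    (Sigma : set (word T Y * word T Y)) (ntV : has_nontrivial Sigma)
    (X : pA G Sigma) :
  (has_globalization X <->
   forall (x y : G) (a b : X),
     ThetaV Sigma (AU_palg X) (letterV Sigma (AU_class (pA_act X) x a))
                              (letterV Sigma (AU_class (pA_act X) y b)) ->
     AU_class (pA_act X) x a = AU_class (pA_act X) y b) /\
  (has_globalization X -> is_universal_globalization X (WVU X) (iotaU X)).
Proof.
split; [split|].
- by move=> [B [iota iotaP]] x y a b /letterP/(letter_inj iotaP).
- move=> inj; exists (WVU X), (iotaU X); apply: WVU_globalization => p q.
  have [x [a ->]] := AU_class_surj p; have [y [b ->]] := AU_class_surj q.
  by move=> /letterP; exact: inj.
- move=> [B [iota iotaP]]; split; last exact: WVU_factor.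
  by apply: WVU_globalization; exact: letter_inj iotaP.
Qed.
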